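(* Let $\mathbb X,\mathbb Y$ be Hilbert spaces over $\mathbb K\in\{\mathbb R,\mathbb C\}$, let $\mathbf A\colon\mathbb X\to\mathbb Y$ be bounded linear, let $(\mathbf U,\mathbf V,\boldsymbol\kappa)=(u_\lambda,v_\lambda,\kappa_\lambda)_{\lambda\in\Lambda}$ be a diagonal frame decomposition (DFD) for $\mathbf A$, and let $\boldsymbol d=(d_\lambda)_{\lambda\in\Lambda}\in\mathbb R^\Lambda$ satisfy $\inf_{\lambda\in\Lambda}d_\lambda>0$. For $\alpha>0$ let $\mathbf B_\alpha^{\rm DFD}:=\bar{\mathbf U}\circ\mathbf M_{\boldsymbol\kappa}^{+}\circ\mathbb S_{\alpha\boldsymbol d/\boldsymbol\kappa}\circ\mathbf V^*\colon\mathbb Y\to\mathbb X$ be the DFD soft-thresholding estimator. Let $x^{+}\in\mathbb X$ be such that $\mathbf U^*x^+=(\langle x^+,u_\lambda\rangle)_{\lambda\in\Lambda}$ is sparse, i.e. the set $\{\lambda\in\Lambda:\langle x^+,u_\lambda\rangle\ne0\}$ is finite, and such that $\kappa_\lambda\neq0$ for every $\lambda$ in this set. Let $C\in(0,\infty)$. Then there is a constant $c_+\in(0,\infty)$ such that for all $\delta>0$ and all $y_\delta\in\mathbb Y$ with $\|\mathbf A x^{+}-y_\delta\|\le\delta$, the parameter choice $\alpha=C\delta$ gives $$\|\mathbf B_\alpha^{\rm DFD}(y_\delta)-x^{+}\|\le c_+\,\delta.$$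
   Context: A diagonal frame decomposition (DFD) for $\mathbf A$ is a family $(u_\lambda,v_\lambda,\kappa_\lambda)_{\lambda\in\Lambda}$ with $u_\lambda\in\mathbb X$, $v_\lambda\in\mathbb Y$, $\kappa_\lambda>0$ such that: (D1) $(u_\lambda)_\lambda$ is a frame of $\mathbb X$; (D2) $(v_\lambda)_\lambda$ is a frame of $\overline{\operatorname{ran}(\mathbf A)}$; (D3) $\mathbf A^*v_\lambda=\kappa_\lambda u_\lambda$ for all $\lambda\in\Lambda$. (A frame of a Hilbert space $H$ is a family $(f_\lambda)$ in $H$ with constants $0<a\le b<\infty$ such that $a\|x\|^2\le\sum_\lambda|\langle x,f_\lambda\rangle|^2\le b\|x\|^2$ for all $x\in H$.) The synthesis operator of the frame $(u_\lambda)_\lambda$ is $\mathbf U\colon\ell^2(\Lambda)\to\mathbb X$, $\xi\mapsto\sum_\lambda\xi_\lambda u_\lambda$, with adjoint (analysis operator) $\mathbf U^*x=(\langle x,u_\lambda\rangle)_\lambda$; likewise $\mathbf V$ for $(v_\lambda)_\lambda$, with $\mathbf V^*\colon\mathbb Y\to\ell^2(\Lambda)$, $\mathbf V^*y=(\langle y,v_\lambda\rangle)_\lambda$ (inner products are linear in the first argument). $\bar{\mathbf U}$ is the synthesis operator of the canonical dual frame $(\bar u_\lambda)_\lambda$ of $(u_\lambda)_\lambda$, $\bar u_\lambda=(\mathbf U\mathbf U^* )^{-1}u_\lambda$, so that $\bar{\mathbf U}\mathbf U^*=\operatorname{Id}_{\mathbb X}$. Soft-thresholding: for $\eta\in\mathbb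 K$ and $d\ge 0$, $\operatorname{soft}(\eta,d):=\operatorname{sign}(\eta)\max\{0,|\eta|-d\}$ with $\operatorname{sign}(\eta)=\eta/|\eta|$ for $\eta\ne0$ and $\operatorname{sign}(0)=0$; for families, $\mathbb S_{\boldsymbol d}(\boldsymbol\eta):=(\operatorname{soft}(\eta_\lambda,d_\lambda))_{\lambda}$. Here $\alpha\boldsymbol d/\boldsymbol\kappa=(\alpha d_\lambda/\kappa_\lambda)_\lambda$. $\mathbf M_{\boldsymbol\kappa}^+$ is pointwise division, $(\mathbf M_{\boldsymbol\kappa}^+\boldsymbol\eta)_\lambda=\eta_\lambda/\kappa_\lambda$. *)

(* Defs.v *)
From HB Require Import structures.
From mathcomp Require Import all_boot all_order all_algebra.
From mathcomp Require Import sesquilinear complex.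
From mathcomp Require Import all_classical all_reals all_analysis.
From mathcomp Require summability.

Set Implicit Arguments.
Unset Strict Implicit.
Unset Printing Implicit Defensive.

Import Order.TTheory GRing.Theory Num.Theory.
Import numFieldNormedType.Exports.
Local Open Scope classical_set_scope.
Local Open Scope ring_scope.

Variant base_field_kind := RealBase | ComplexBase.

Definition base_field (R : realType) (k : base_field_kind) : numFieldType :=
  match k with RealBase => R | ComplexBase => R[i] end.

Definition conjK (R : realType) (k : base_field_kind) : base_field R k -> base_field R k :=
  match k with RealBase => idfun | ComplexBase => @conjc R end.

Definition ofR (R : realType) (k : base_field_kind) : R -> base_field R k :=
  match k with RealBase => idfun | ComplexBase => real_complex R end.

Definition reK (R : realType) (k : base_field_kind) : base_field R k -> R :=
  match k with RealBase => idfun | ComplexBase => @complex.Re R end.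

Section Scalars.
Variables (R : realType) (k : base_field_kind).

(* The library norm over a numeric field takes its (real) values in that field;
   this is the same norm with values in R. *)
Definition rnorm (V : normedZmodType (base_field R k)) (x : V) : R := reK `|x|.

Definition sign (eta : base_field R k) : base_field R k :=
  if eta == 0 then 0 else eta / `|eta|.

Definition soft (eta : base_field R k) (t : R) : base_field R k :=
  sign eta * ofR k (Num.max 0 (rnorm eta - t)).

End Scalars.

(* Linear in the first argument, conjugate-linear in the second. *)
HB.mixin Record CompleteNormedModule_isHilbert (R : realType) (k : base_field_kind)
    X of CompleteNormedModule (base_field R k) X := {
  inner : {dot X for @conjK R k} ;
  inner_norm : forall x : X, inner x x = `|x| ^+ 2
}.

#[short(type="hilbertType")]
HB.structure Definition Hilbert (R : realType) (k : base_field_kind) :=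
  {X of CompleteNormedModule (base_field R k) X
      & CompleteNormedModule_isHilbert R k X}.

Section Operators.
Variables (R : realType) (k : base_field_kind) (X Y : hilbertType R k).

Definition bounded_operator (A : X -> Y) : Prop :=
  exists M : R, forall x, rnorm (A x) <= M * rnorm x.

(* The Riesz representative of x |-> <A x, y>, which exists and is unique when
   A is bounded linear. *)
Definition adjoint (A : X -> Y) (y : Y) : X :=
  xget 0 [set z | forall x, inner (A x) y = inner x z].

End Operators.

Section Frames.
Variables (R : realType) (k : base_field_kind) (H : hilbertType R k).
Variable (Lambda : choiceType).
Implicit Types (E : set H) (f : Lambda -> H).

(* f is a frame of the closed subspace E, itself a Hilbert space with the
   induced inner product. *)
Definition is_frame E f : Prop :=
  (forall l, E (f l)) /\
  exists a b : R, [/\ 0 < a, a <= b &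
    forall x, E x ->
      ((a * rnorm x ^+ 2)%:E
         <= \esum_(l in [set: Lambda]) (rnorm (inner x (f l)) ^+ 2)%:E
         <= (b * rnorm x ^+ 2)%:E)%E].

(* The limit of the finite partial sums; it is meant for square-summable xi
   (for which it converges when f is a frame), and unspecified otherwise. *)
Definition synthesis f (xi : Lambda -> base_field R k) : H :=
  summability.sum (fun l => xi l *: f l).

Definition analysis f (x : H) : Lambda -> base_field R k :=
  fun l => inner x (f l).

Definition frame_operator f : H -> H := synthesis f \o analysis f.

Definition canonical_dual f : Lambda -> H :=
  fun l => 'pinv_(fun=> 0) setT (frame_operator f) (f l).

End Frames.

Section DFD.
Variables (R : realType) (k : base_field_kind) (X Y : hilbertType R k).
Variable (Lambda : choiceType).
Implicit Types (A : X -> Y) (u : Lambda -> X) (v : Lambda -> Y).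
Implicit Types (kappa d : Lambda -> R) (eta : Lambda -> base_field R k).

Record is_DFD A u v kappa : Prop := IsDFD {
  DFD_kappa_gt0 : forall l, 0 < kappa l ;
  DFD_frame_u : is_frame setT u ;
  DFD_frame_v : is_frame (closure (range A)) v ;
  DFD_adjoint : forall l, adjoint A (v l) = ofR k (kappa l) *: u l
}.

Definition soft_threshold d eta : Lambda -> base_field R k :=
  fun l => soft (eta l) (d l).

Definition pointwise_div kappa eta : Lambda -> base_field R k :=
  fun l => eta l / ofR k (kappa l).

(* For alpha > 0 and inf d > 0 the synthesized family is square-summable:
   its l-th entry vanishes unless |<y, v l>| * kappa l > alpha * d l. *)
Definition DFD_estimator u v kappa d (alpha : R) : Y -> X :=
  synthesis (canonical_dual u) \o pointwise_div kappa
    \o soft_threshold (fun l => alpha * d l / kappa l) \o analysis v.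

End DFD.

(* Main.v *)
(* The coefficient error e = xi - U^* x, where xi are the thresholded and rescaled
   coefficients of y, satisfies sum |e_l|^2 = O(delta^2): on the finite support of
   U^* x each entry is O(delta), and off the support the entry is bounded by
   |<y - A x, v_l>|^2 / (C delta inf d), whose squares are summable with sum
   O(delta^2) by the Bessel bound of v.  Applying the bounded synthesis operator of
   the dual frame gives the rate.  Invertibility of the frame operator S follows from
   its coercivity, by the iteration r |-> r - S r / b, and it yields the Riesz
   representation behind the adjoint. *)
From HB Require Import structures.
Require Import Defs.
From mathcomp Require Import all_boot all_order all_algebra.
From mathcomp Require Import sesquilinear complex finmap.
From mathcomp Require Import all_classical all_reals all_analysis.
From mathcomp Require summability.
From mathcomp Require Import ring lra.

Set Implicit Arguments.
Unset Strict Implicit.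
Unset Printing Implicit Defensive.

Import Order.TTheory GRing.Theory Num.Theory.
Import numFieldNormedType.Exports.
Local Open Scope classical_set_scope.
Local Open Scope ring_scope.

(** * Real and complex scalars treated uniformly, with norms valued in [R] *)

Section ScalarTheory.
Variables (R : realType) (k : base_field_kind).
Local Notation K := (base_field R k).
Implicit Types (a b : K) (r s : R).

Lemma ofR_zmod_morphism : zmod_morphism (@ofR R k).
Proof. by case: k => // r s; rewrite /ofR rmorphB. Qed.

Lemma ofR_monoid_morphism : monoid_morphism (@ofR R k).
Proof. by case: k => //; split=> [|r s]; rewrite /ofR ?rmorph1 ?rmorphM. Qed.

HB.instance Definition _ :=
  GRing.isZmodMorphism.Build R K (@ofR R k) ofR_zmod_morphism.
HB.instance Definition _ :=
  GRing.isMonoidMorphism.Build R K (@ofR R k) ofR_monoid_morphism.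

Lemma reK_zmod_morphism : zmod_morphism (@reK R k).
Proof. by case: k => // -[a b] [c d]. Qed.

HB.instance Definition _ :=
  GRing.isZmodMorphism.Build K R (@reK R k) reK_zmod_morphism.

Lemma ler_ofR r s : (ofR k r <= ofR k s) = (r <= s).
Proof. by case: k => //; rewrite /ofR lecR. Qed.

Lemma ltr_ofR r s : (ofR k r < ofR k s) = (r < s).
Proof. by case: k => //; rewrite /ofR ltcR. Qed.

Lemma ofRK : cancel (@ofR R k) (@reK R k).
Proof. by case: k. Qed.

(** Comparability with 0 in [R[i]] forces a zero imaginary part; this is the bridge between the
    library norm and [rnorm]. *)
Lemma ge0_ofR_reK a : 0 <= a -> ofR k (reK a) = a.
Proof.
move: a; case: k => // -[a b] /=; rewrite lecE /= => /andP[/eqP -> _].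
by [].
Qed.

Lemma ofR_ge0 r : (0 <= ofR k r) = (0 <= r).
Proof. by rewrite -ler_ofR rmorph0. Qed.

Lemma ofR_gt0 r : (0 < ofR k r) = (0 < r).
Proof. by rewrite -ltr_ofR rmorph0. Qed.

Lemma reK_gt0 a : 0 < a -> 0 < reK a.
Proof. by move=> a0; rewrite -ofR_gt0 ge0_ofR_reK// ltW. Qed.

Lemma reK_ge0 a : 0 <= a -> 0 <= reK a.
Proof. by move=> a0; rewrite -ofR_ge0 ge0_ofR_reK. Qed.

Lemma reK_ofRM r a : reK (ofR k r * a) = r * reK a.
Proof. by move: a; case: k => // -[a b] /=; rewrite mul0r subr0. Qed.

Lemma conjK_conj a : conjK (conjK a) = a.
Proof. by move: a; case: k => // a; exact: conjcK. Qed.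

Lemma conjK_ofR r : conjK (ofR k r) = ofR k r.
Proof. by case: k => //; exact: conjc_real. Qed.

Lemma reK_conj a : reK (conjK a) = reK a.
Proof. by move: a; case: k => // -[a b]. Qed.

Lemma mul_conjK a : a * conjK a = `|a| ^+ 2.
Proof.
move: a; case: k => a; first by rewrite /= real_normK// num_real.
by rewrite /= sqr_normc.
Qed.

Section Norm.
Variable V : normedModType K.
Implicit Types x y : V.

Lemma ofR_rnorm x : ofR k (rnorm x) = `|x|.
Proof. by rewrite ge0_ofR_reK. Qed.

Lemma rnorm_ge0 x : 0 <= rnorm x.
Proof. exact: reK_ge0. Qed.

Lemma rnorm0 : rnorm (0 : V) = 0.
Proof. by rewrite /rnorm normr0 raddf0. Qed.

Lemma rnorm0_eq0 x : rnorm x = 0 -> x = 0.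
Proof. by move=> x0; apply/normr0_eq0; rewrite -ofR_rnorm x0 rmorph0. Qed.

Lemma rnormN x : rnorm (- x) = rnorm x.
Proof. by rewrite /rnorm normrN. Qed.

Lemma rnormD x y : rnorm (x + y) <= rnorm x + rnorm y.
Proof. by rewrite -ler_ofR rmorphD/= !ofR_rnorm ler_normD. Qed.

Lemma rnormBC x y : rnorm (x - y) = rnorm (y - x).
Proof. by rewrite /rnorm distrC. Qed.

Lemma rnormZ a x : rnorm (a *: x) = rnorm a * rnorm x.
Proof.
apply: (can_inj ofRK); rewrite rmorphM/= !ofR_rnorm normrZ.
by rewrite ge0_ofR_reK.
Qed.

End Norm.

Lemma ofR_rnormK a : ofR k (rnorm a) = `|a|.
Proof. exact: (ofR_rnorm (V := K^o)). Qed.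

Lemma rnormM a b : rnorm (a * b) = rnorm a * rnorm b.
Proof. exact: (rnormZ (V := K^o)). Qed.

Lemma rnorm_ofR r : rnorm (ofR k r) = `|r|.
Proof.
have h s : 0 <= s -> rnorm (ofR k s) = s.
  by move=> s0; rewrite /rnorm ger0_norm ?ofRK// ofR_ge0.
have [r0|r0] := leP 0 r; first by rewrite h ?ger0_norm.
by rewrite ltr0_norm// -[- r]h ?oppr_ge0 1?ltW// raddfN /rnorm normrN.
Qed.

Lemma rnorm_conjK a : rnorm (conjK a) = rnorm a.
Proof.
move: a; case: k => // a; rewrite /rnorm /conjK; congr reK; exact: normcJ.
Qed.

Lemma ler_reK_rnorm a : `|reK a| <= rnorm a.
Proof.
rewrite -ler_ofR ofR_rnormK; move: a; case: k => // a; exact: normc_ge_Re.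
Qed.

Lemma mul_conjK_rnorm a : a * conjK a = ofR k (rnorm a ^+ 2).
Proof. by rewrite mul_conjK rmorphXn /= ofR_rnormK. Qed.

End ScalarTheory.

(** * Inner product identities and the Cauchy-Schwarz inequality *)

Section InnerTheory.
Variables (R : realType) (k : base_field_kind) (H : hilbertType R k).
Local Notation K := (base_field R k).
Implicit Types (x y z : H) (a b : K).

Lemma inner_conj x y : inner y x = conjK (inner x y).
Proof. by rewrite hermitian_subproof mul1r. Qed.

Lemma innerZl a x y : inner (a *: x) y = a * inner x y.
Proof. exact: linearZl_LR. Qed.

Lemma innerZr a x y : inner x (a *: y) = conjK a * inner x y.
Proof. exact: (linearZr_LR inner). Qed.

Lemma innerDl x y z : inner (x + y) z = inner x z + inner y z.
Proof. exact: linearDl. Qed.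

Lemma innerBl x y z : inner (x - y) z = inner x z - inner y z.
Proof. exact: linearBl. Qed.

Lemma innerBr x y z : inner z (x - y) = inner z x - inner z y.
Proof. exact: linearBr. Qed.

Lemma inner_suml (I : Type) (s : seq I) (F : I -> H) y :
  inner (\sum_(i <- s) F i) y = \sum_(i <- s) inner (F i) y.
Proof. exact: linear_sumlz. Qed.

Lemma inner_rnorm x : inner x x = ofR k (rnorm x ^+ 2).
Proof. by rewrite inner_norm rmorphXn/= ofR_rnorm. Qed.

Lemma reK_inner_conj x y : reK (inner y x) = reK (inner x y).
Proof. by rewrite inner_conj reK_conj. Qed.

(** The squared norm of [N x - c y], with [N] the squared norm of [y] and [c] the inner product, is
    [N] times the defect of the squared inequality. Scaling [x] by [N] avoids a division. *)
Lemma cauchy_schwarz x y : rnorm (inner x y) <= rnorm x * rnorm y.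
Proof.
have [/eqP y0|y0] := boolP (rnorm y == 0).
  by rewrite (rnorm0_eq0 y0) linear0r !rnorm0 mulr0.
have y_gt0 : 0 < rnorm y ^+ 2 by rewrite exprn_gt0// lt_def y0 rnorm_ge0.
pose N := rnorm y ^+ 2; pose c := inner x y.
have /eqP : inner (ofR k N *: x - c *: y) (ofR k N *: x - c *: y) =
    ofR k (N * (N * rnorm x ^+ 2 - rnorm c ^+ 2)).
  rewrite innerBl !innerBr !innerZl !innerZr (inner_conj x y) -/c.
  rewrite !inner_rnorm -/N conjK_ofR (rmorphM _ N) rmorphB/= (rmorphM _ N).
  by rewrite -mul_conjK_rnorm; ring.
rewrite inner_rnorm => /eqP /(can_inj (@ofRK R k)) E.
have : 0 <= N * (N * rnorm x ^+ 2 - rnorm c ^+ 2) by rewrite -E sqr_ge0.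
rewrite pmulr_rge0// subr_ge0 mulrC -exprMn.
by rewrite ler_pXn2r// ?nnegrE ?mulr_ge0 ?rnorm_ge0.
Qed.

Lemma rnorm_subZ_sqr x y (t : R) :
  rnorm (x - ofR k t *: y) ^+ 2 =
  rnorm x ^+ 2 - 2 * t * reK (inner y x) + t ^+ 2 * rnorm y ^+ 2.
Proof.
have reK_inner z : reK (inner z z) = rnorm z ^+ 2 by rewrite inner_rnorm ofRK.
rewrite -reK_inner innerBl !innerBr !innerZl !innerZr conjK_ofR.
rewrite !raddfB/= !reK_ofRM !reK_inner (reK_inner_conj y x).
by ring.
Qed.

End InnerTheory.

(** * Bessel bounds on finite sums *)

Section FiniteSynthesis.
Variables (R : realType) (k : base_field_kind) (H : hilbertType R k).
Variable Lambda : choiceType.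
Local Notation K := (base_field R k).
Implicit Types (f : Lambda -> H) (c : Lambda -> K) (F : {fset Lambda}).

(** The Bessel property in its synthesis form, stated on finite sums so that it makes sense before
    any convergence is known. *)
Definition synthesis_bound f (B : R) : Prop := forall F c,
  rnorm (\sum_(l <- F) c l *: f l) ^+ 2 <= B * \sum_(l <- F) rnorm (c l) ^+ 2.

Lemma sum_mul_AMGM (b : R) (s : seq Lambda) (p q : Lambda -> R) : 0 < b ->
  \sum_(l <- s) p l * q l <=
  (b * \sum_(l <- s) p l ^+ 2 + b^-1 * \sum_(l <- s) q l ^+ 2) / 2.
Proof.
move=> b0; rewrite !mulr_sumr -big_split/= mulr_suml ler_sum// => l _.
rewrite ler_pdivlMr// -subr_ge0.
have -> : b * p l ^+ 2 + b^-1 * q l ^+ 2 - p l * q l * 2 =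
    b^-1 * (b * p l - q l) ^+ 2 by field; rewrite gt_eqF.
by rewrite mulr_ge0 ?sqr_ge0// invr_ge0 ltW.
Qed.

Lemma reK_inner_sum_le F c f (z : H) :
  reK (inner (\sum_(l <- F) c l *: f l) z) <=
  \sum_(l <- F) rnorm (c l) * rnorm (inner z (f l)).
Proof.
rewrite inner_suml raddf_sum/= ler_sum// => l _.
rewrite innerZl (le_trans (ler_norm _))// (le_trans (ler_reK_rnorm _))//.
by rewrite rnormM (inner_conj z) rnorm_conjK.
Qed.

Lemma inner_sum_analysis F f (z : H) :
  inner (\sum_(l <- F) analysis f z l *: f l) z =
  ofR k (\sum_(l <- F) rnorm (analysis f z l) ^+ 2).
Proof.
rewrite inner_suml raddf_sum/=; apply: eq_bigr => l _.
by rewrite innerZl (inner_conj z) mul_conjK_rnorm.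
Qed.

(** The Bessel inequality is asked only on the span of [f], since for [v] it is given only on the
    closure of the range. Expanding the inner product of [w] with itself and applying the weighted
    AM-GM leaves half the squared norm of [w] on the right, which is absorbed. *)
Lemma synthesis_bound_span f (B : R) : 0 < B ->
  (forall F c, let w := \sum_(l <- F) c l *: f l in
    \sum_(l <- F) rnorm (analysis f w l) ^+ 2 <= B * rnorm w ^+ 2) ->
  synthesis_bound f B.
Proof.
move=> B0 h F c; have := h F c; set w := \sum_(l <- F) c l *: f l => /= hw.
have := reK_inner_sum_le F c f w; rewrite -/w inner_rnorm ofRK => h1.
have h2 := sum_mul_AMGM F (fun l => rnorm (c l)) (fun l => rnorm (inner w (f l))) B0.
have h3 : B^-1 * \sum_(l <- F) rnorm (analysis f w l) ^+ 2 <= rnorm w ^+ 2.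
  by rewrite ler_pdivrMl.
rewrite /analysis in h3; lra.
Qed.

(** Duality: [T] is the inner product of [w] with [z], while the squared norm of [w] is at most
    [B T]. This carries the Bessel inequality from the span to every [z], as noise may leave the
    closure of the range. *)
Lemma analysis_bound f (B : R) : 0 < B -> synthesis_bound f B ->
  forall F (z : H),
    \sum_(l <- F) rnorm (analysis f z l) ^+ 2 <= B * rnorm z ^+ 2.
Proof.
move=> B0 hf F z; set T := \sum_(l <- F) _.
have := hf F (analysis f z); rewrite -/T; set w := \sum_(l <- F) _ *: _ => hw.
have hT : T <= rnorm z * rnorm w.
  rewrite mulrC (le_trans _ (cauchy_schwarz _ _))// inner_sum_analysis -/T.
  by rewrite rnorm_ofR ler_norm.
have hw' : B^-1 * rnorm w ^+ 2 <= T by rewrite ler_pdivrMl.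
have : 0 <= B^-1 * (B * rnorm z - rnorm w) ^+ 2.
  by rewrite mulr_ge0 ?sqr_ge0// invr_ge0 ltW.
have -> : B^-1 * (B * rnorm z - rnorm w) ^+ 2 =
    B * rnorm z ^+ 2 + B^-1 * rnorm w ^+ 2 - 2 * (rnorm z * rnorm w).
  by field; rewrite gt_eqF.
lra.
Qed.

End FiniteSynthesis.

(** * Unconditional summation along finite index sets *)

Section Convergence.
Variables (R : realType) (k : base_field_kind) (H : hilbertType R k).
Local Notation K := (base_field R k).

Lemma cvg_rnormP (T : Type) (F : set_system T) {FF : Filter F} (g : T -> H) (y : H) :
  (g @ F --> y) <-> forall e : R, 0 < e -> F [set i | rnorm (y - g i) < e].
Proof.
split=> [/cvgrPdist_lt gy e e0|gy].
  have e0' : 0 < ofR k e by rewrite ofR_gt0.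
  by apply: filterS (gy _ e0') => i /=; rewrite -ofR_rnorm ltr_ofR.
apply/cvgrPdist_lt => e e0; have e0' := reK_gt0 e0.
apply: filterS (gy _ e0') => i /=.
by rewrite -(ltr_ofR k) ofR_rnorm ge0_ofR_reK// ltW.
Qed.

Lemma cvg_rnorm_ex (T : Type) (F : set_system T) {FF : ProperFilter F} (g : T -> H) :
  (forall e : R, 0 < e -> exists x, F [set i | rnorm (x - g i) < e]) ->
  exists y : H, g @ F --> y.
Proof.
move=> hg; apply/cvg_ex/(cauchy_cvgP (T := H))/cauchy_exP => e e0; have e0' := reK_gt0 e0.
have [x hx] := hg _ e0'; exists x.
suff: F [set i | ball x e (g i)] by [].
apply: filterS hx => i /=.
by rewrite -(ltr_ofR k) ofR_rnorm ge0_ofR_reK ?(ltW e0)// -ball_normE.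
Qed.

Variable Lambda : choiceType.
Implicit Types (f : Lambda -> H) (c : Lambda -> K) (F : {fset Lambda}).

Definition has_sum (g : Lambda -> H) (y : H) : Prop :=
  summability.partial_sum g @ summability.totally --> y.

Local Existing Instance summability.totally_filter.

Lemma partial_sumE (g : Lambda -> H) F :
  summability.partial_sum g F = \sum_(l <- F) g l.
Proof. by rewrite /summability.partial_sum big_seq_fsetE. Qed.

Lemma has_sumP (g : Lambda -> H) (y : H) : has_sum g y <->
  forall e : R, 0 < e -> exists F0, forall F, (F0 `<=` F)%fset ->
    rnorm (y - \sum_(l <- F) g l) < e.
Proof.
rewrite /has_sum cvg_rnormP; split=> hg e e0.
  have [F0 _ h] := hg _ e0; exists F0 => F FF0.
  by rewrite -partial_sumE; exact: h.
by have [F0 h] := hg _ e0; exists F0 => // F FF0 /=; rewrite partial_sumE h.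
Qed.

Lemma has_sum_unique (g : Lambda -> H) y : has_sum g y -> summability.sum g = y.
Proof. exact: cvg_lim. Qed.

Lemma has_sumD (g h : Lambda -> H) y z : has_sum g y -> has_sum h z ->
  has_sum (fun l => g l + h l) (y + z).
Proof.
rewrite /has_sum => gy hz.
rewrite (_ : summability.partial_sum _ =
    summability.partial_sum g \+ summability.partial_sum h); last first.
  by apply/funext => F /=; rewrite !partial_sumE big_split.
exact: cvgD.
Qed.

Lemma has_sumZ (a : K) (g : Lambda -> H) y : has_sum g y ->
  has_sum (fun l => a *: g l) (a *: y).
Proof.
rewrite /has_sum => gy.
rewrite (_ : summability.partial_sum _ =
    (fun F => a *: summability.partial_sum g F)); last first.
  by apply/funext => F; rewrite !partial_sumE scaler_sumr.
exact: cvgZr.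
Qed.

Lemma sum_setD (V : zmodType) (p : Lambda -> V) F0 F : (F0 `<=` F)%fset ->
  \sum_(l <- F) p l = \sum_(l <- F0) p l + \sum_(l <- (F `\` F0)%fset) p l.
Proof.
move=> F0F; rewrite (big_fsetID _ (mem F0)) /=; congr (_ + _).
  apply: eq_fbigl => l; rewrite !inE /=.
  by apply/andP/idP => [[]//|lF0]; split=> //; exact: (fsubsetP F0F).
by apply: eq_fbigl => l; rewrite !inE /= andbC.
Qed.

Lemma ler_sum_fsubset (p : Lambda -> R) F0 F : (forall l, 0 <= p l) ->
  (F0 `<=` F)%fset -> \sum_(l <- F0) p l <= \sum_(l <- F) p l.
Proof. by move=> p0 /sum_setD ->; rewrite lerDl sumr_ge0. Qed.

Lemma has_sum_rnorm_le (g : Lambda -> H) y (M : R) :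
  has_sum g y -> (forall F, rnorm (\sum_(l <- F) g l) <= M) -> rnorm y <= M.
Proof.
move=> /has_sumP gy gM; apply/ler_addgt0Pr => e e0.
have [F0 /(_ F0 (fsubset_refl _)) h] := gy _ e0.
rewrite -(subrK (\sum_(l <- F0) g l) y) addrC.
by rewrite (le_trans (rnormD _ _))// addrC [leLHS]addrC lerD// ltW.
Qed.

(** Cauchy criterion: once a finite set nearly exhausts the supremum of the sums of [|c l|^2], the
    synthesis bound makes every further block small. *)
Lemma synthesis_has_sum f c (B M : R) : 0 < B -> synthesis_bound f B ->
  (forall F, \sum_(l <- F) rnorm (c l) ^+ 2 <= M) ->
  exists y, has_sum (fun l => c l *: f l) y.
Proof.
move=> B0 hf hM; apply: cvg_rnorm_ex => e e0.
pose T F := \sum_(l <- F) rnorm (c l) ^+ 2.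
have supT : has_sup (range T).
  by split; [exists (T fset0); exists fset0|exists M; move=> _ [F _ <-]; exact: hM].
have e1 : 0 < e ^+ 2 / B by rewrite divr_gt0// exprn_gt0.
have [_ [F0 _ <-] hF0] := sup_adherent e1 supT.
exists (\sum_(l <- F0) c l *: f l); exists F0 => // F F0F /=.
rewrite partial_sumE (sum_setD _ F0F) opprD addNKr rnormN.
rewrite -(ltr_pXn2r (n := 2)) ?nnegrE ?rnorm_ge0 ?(ltW e0)//.
rewrite (le_lt_trans (hf _ _))// -ltr_pdivlMl// mulrC.
have : T F <= sup (range T) by apply: sup_upper_bound => //; exists F.
rewrite /T (sum_setD _ F0F) -/(T F0).
by rewrite -lerBrDl => /le_lt_trans; apply; rewrite ltrBlDl -ltrBlDr.
Qed.

Lemma synthesis_limit_bound f c (B M : R) y : 0 < B -> synthesis_bound f B ->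
  (forall F, \sum_(l <- F) rnorm (c l) ^+ 2 <= M) ->
  has_sum (fun l => c l *: f l) y -> rnorm y ^+ 2 <= B * M.
Proof.
move=> B0 hf hM hy; have M0 : 0 <= M.
  by apply: le_trans (hM fset0); rewrite sumr_ge0// => l _; rewrite sqr_ge0.
have BM0 : 0 <= B * M by rewrite mulr_ge0// ltW.
rewrite -(sqr_sqrtr BM0) ler_pXn2r ?nnegrE ?rnorm_ge0 ?sqrtr_ge0//.
apply: (has_sum_rnorm_le hy) => F.
rewrite -(ler_pXn2r (n := 2)) ?nnegrE ?rnorm_ge0 ?sqrtr_ge0// sqr_sqrtr//.
by rewrite (le_trans (hf _ _))// ler_wpM2l// ltW.
Qed.

End Convergence.

(** * The frame operator: linearity, coercivity and upper bound *)

Section FrameOperator.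
Variables (R : realType) (k : base_field_kind) (H : hilbertType R k).
Variable Lambda : choiceType.
Local Notation K := (base_field R k).
Implicit Types (f : Lambda -> H) (c : Lambda -> K) (F : {fset Lambda}).

(** Trades the extended-real sum for finite sums: all obey the upper bound, and some come within [e]
    of the lower one. *)
Lemma is_frame_bounds (E : set H) f : is_frame E f ->
  exists a b : R, [/\ 0 < a, a <= b,
    forall x F, E x -> \sum_(l <- F) rnorm (analysis f x l) ^+ 2 <= b * rnorm x ^+ 2 &
    forall x (e : R), E x -> 0 < e -> exists F,
      a * rnorm x ^+ 2 - e < \sum_(l <- F) rnorm (analysis f x l) ^+ 2].
Proof.
move=> [_ [a [b [a0 ab h]]]]; exists a, b; split=> // x.
  move=> F /h /andP[_ hx]; rewrite -lee_fin (le_trans _ hx)// esum_ge//.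
  exists [set` F]; first by split.
  by rewrite -fsbig_seq// sumEFin.
move=> e /h /andP[hx _] e0.
have /ereal_sup_gt [_ [A [finA _] <-]] :
    ((a * rnorm x ^+ 2 - e)%:E <
     \esum_(l in [set: Lambda]) (rnorm (inner x (f l)) ^+ 2)%:E)%E.
  by rewrite (lt_le_trans _ hx)// lte_fin ltrBlDr ltrDl.
by rewrite fsbig_finite// sumEFin lte_fin => h1; exists (fset_set A).
Qed.

Variables (u : Lambda -> H) (a b : R).
Hypotheses (a_gt0 : 0 < a) (le_ab : a <= b).
Hypothesis u_upper : forall x F,
  \sum_(l <- F) rnorm (analysis u x l) ^+ 2 <= b * rnorm x ^+ 2.
Hypothesis u_lower : forall x (e : R), 0 < e -> exists F,
  a * rnorm x ^+ 2 - e < \sum_(l <- F) rnorm (analysis u x l) ^+ 2.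

Let b_gt0 : 0 < b. Proof. exact: lt_le_trans le_ab. Qed.
Local Notation S := (frame_operator u).

Lemma frame_synthesis_bound : synthesis_bound u b.
Proof. by apply: synthesis_bound_span => // F c; exact: u_upper. Qed.

Lemma frame_operator_has_sum x : has_sum (fun l => analysis u x l *: u l) (S x).
Proof.
have [y hy] := synthesis_has_sum b_gt0 frame_synthesis_bound (u_upper x).
by rewrite /frame_operator /= /synthesis (has_sum_unique hy).
Qed.

Lemma frame_operator_linear : linear S.
Proof.
move=> t x y; rewrite {1}/frame_operator /= /synthesis.
apply: has_sum_unique.
have := has_sumD (has_sumZ (a := t) (frame_operator_has_sum (x := x)))
  (frame_operator_has_sum (x := y)).
congr has_sum; apply/funext => l.
by rewrite /analysis scalerA -scalerDl -innerZl innerDl.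
Qed.

Lemma frame_operator_ge_sum x F :
  \sum_(l <- F) rnorm (analysis u x l) ^+ 2 <= reK (inner (S x) x).
Proof.
apply/ler_addgt0Pr => e e0.
have e1 : 0 < e / (rnorm x + 1) by rewrite divr_gt0// ltr_wpDl// rnorm_ge0.
have /has_sumP/(_ _ e1)[F0 hF0] := frame_operator_has_sum (x := x).
(* Enlarging [F] only increases the sum of squares, and on the larger set the partial sum [w] is
   already close to [S x]. *)
have /hF0 : (F0 `<=` F `|` F0)%fset by rewrite fsubsetUr.
set w := \sum_(l <- _) _ => hw.
apply: (@le_trans _ _ (reK (inner w x))).
  by rewrite inner_sum_analysis ofRK ler_sum_fsubset ?fsubsetUl// => l; exact: sqr_ge0.
rewrite -lerBlDl -raddfB/= -innerBl (le_trans (ler_norm _))//.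
rewrite (le_trans (ler_reK_rnorm _))// (le_trans (cauchy_schwarz _ _))//.
rewrite rnormBC (le_trans (ler_wpM2r (rnorm_ge0 _) (ltW hw)))//.
rewrite mulrAC ler_pdivrMr ?ltr_wpDl ?rnorm_ge0//.
by rewrite ler_wpM2l ?(ltW e0)// lerDl.
Qed.

Lemma frame_operator_coercive x : a * rnorm x ^+ 2 <= reK (inner (S x) x).
Proof.
apply/ler_addgt0Pr => e e0; have [F] := u_lower x e0.
by rewrite ltrBlDr => /ltW/le_trans; apply; rewrite lerD2r frame_operator_ge_sum.
Qed.

(** [S x] synthesizes coefficients whose squares sum to at most the inner product of [S x] with [x].
    This quadratic-form bound plays the part of the operator inequality between [S^2] and [b S]. *)
Lemma frame_operator_rnorm_sqr x : rnorm (S x) ^+ 2 <= b * reK (inner (S x) x).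
Proof.
apply: (synthesis_limit_bound b_gt0 frame_synthesis_bound (frame_operator_ge_sum x)).
exact: frame_operator_has_sum.
Qed.

End FrameOperator.

(** * Surjectivity of a coercive operator by a relaxation iteration *)

Section CoerciveOperator.
Variables (R : realType) (k : base_field_kind) (H : hilbertType R k).
Local Notation K := (base_field R k).
Variables (S : {linear H -> H}) (a b : R).
Hypotheses (a_gt0 : 0 < a) (le_ab : a <= b).
Hypothesis S_coercive : forall x, a * rnorm x ^+ 2 <= reK (inner (S x) x).
Hypothesis S_sqr : forall x, rnorm (S x) ^+ 2 <= b * reK (inner (S x) x).

Let b_gt0 : 0 < b. Proof. exact: lt_le_trans le_ab. Qed.

Let reK_inner_S_le x : reK (inner (S x) x) <= rnorm (S x) * rnorm x.
Proof.
by rewrite (le_trans (ler_norm _))// (le_trans (ler_reK_rnorm _))// cauchy_schwarz.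
Qed.

Lemma coercive_lower x : a * rnorm x <= rnorm (S x).
Proof.
have [x0|x0] := eqVneq (rnorm x) 0; first by rewrite x0 mulr0 rnorm_ge0.
have x_gt0 : 0 < rnorm x by rewrite lt_def x0 rnorm_ge0.
by rewrite -(ler_pM2r x_gt0) -mulrA -expr2 (le_trans (S_coercive x)).
Qed.

Lemma coercive_upper x : rnorm (S x) <= b * rnorm x.
Proof.
have [S0|S0] := eqVneq (rnorm (S x)) 0.
  by rewrite S0 mulr_ge0 ?rnorm_ge0// ltW.
have S_gt0 : 0 < rnorm (S x) by rewrite lt_def S0 rnorm_ge0.
rewrite -(ler_pM2l S_gt0) -expr2 (le_trans (S_sqr x))// (mulrCA _ b).
by rewrite (ler_pM2l b_gt0).
Qed.

(** In the expanded square, [S_sqr] lets the quadratic term cancel half of the cross term;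
    coercivity turns the other half into the gain [a / b]. *)
Lemma coercive_step x :
  rnorm (x - ofR k b^-1 *: S x) ^+ 2 <= (1 - a / b) * rnorm x ^+ 2.
Proof.
rewrite rnorm_subZ_sqr.
have h1 : b^-1 ^+ 2 * rnorm (S x) ^+ 2 <= b^-1 * reK (inner (S x) x).
  by rewrite expr2 -mulrA ler_pM2l ?invr_gt0// ler_pdivrMl.
have h2 : b^-1 * (a * rnorm x ^+ 2) <= b^-1 * reK (inner (S x) x).
  by rewrite ler_pM2l ?invr_gt0.
have -> : (1 - a / b) * rnorm x ^+ 2 = rnorm x ^+ 2 - b^-1 * (a * rnorm x ^+ 2) by ring.
move: h1 h2; set p := b^-1 * reK _; set r := b^-1 ^+ 2 * _; set t := b^-1 * _.
rewrite -(mulrA 2) -/p; lra.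
Qed.

Lemma coercive_dense_range y (e : R) : 0 < e -> exists x, rnorm (y - S x) < e.
Proof.
(* Each [r n] is the residual [y - S x] of some [x], and [coercive_step] makes it decay
   geometrically. *)
move=> e0; pose r n := iter n (fun r => r - ofR k b^-1 *: S r) y.
have rE n : exists x, y - S x = r n.
  elim: n => [|n [x xr]]; first by exists 0; rewrite linear0 subr0.
  exists (x + ofR k b^-1 *: r n).
  by rewrite linearD linearZ/= opprD addrA xr.
have q0 : 0 <= 1 - a / b by rewrite subr_ge0 ler_pdivrMr// mul1r.
have q1 : 1 - a / b < 1 by rewrite ltrBlDr ltrDl divr_gt0.
have rq n : rnorm (r n) ^+ 2 <= geometric (rnorm y ^+ 2) (1 - a / b) n.
  elim: n => [|n IH]; first by rewrite /= expr0 mulr1.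
  by rewrite (le_trans (coercive_step _))//= (exprS _ n) [leRHS]mulrCA ler_wpM2l.
have /cvgrPdist_lt/(_ _ (exprn_gt0 2 e0))[N _ /(_ N (leqnn _))] :
    geometric (rnorm y ^+ 2) (1 - a / b) n @[n --> \oo] --> (0 : R).
  by apply: cvg_geometric; rewrite ger0_norm.
rewrite sub0r normrN => /(le_lt_trans (ler_norm _))/(le_lt_trans (rq N)).
have [x <-] := rE N; rewrite ltr_pXn2r ?nnegrE ?rnorm_ge0 ?(ltW e0)//.
by exists x.
Qed.

Lemma coercive_surjective y : exists x, S x = y.
Proof.
pose B (e : R) := [set x | rnorm (y - S x) < e].
(* The filter generated by the sets of approximate solutions; its limit will be an exact
   solution. *)
pose F := filter_from [set e : R | 0 < e] B.
have FF : ProperFilter F.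
  apply: filter_from_proper; last by move=> e /(coercive_dense_range y).
  apply: filter_from_filter; first by exists 1 => /=.
  move=> e1 e2 /= e10 e20; exists (Num.min e1 e2); first by rewrite /= lt_min e10.
  by move=> x; rewrite /B /= lt_min => /andP[].
have [e e0|z /cvg_rnormP hz] := @cvg_rnorm_ex _ _ H H F FF id.
  (* Two points with residuals below [a e / 2] have images less than [a e] apart, so
     [coercive_lower] puts them within [e]. *)
  have e'0 : 0 < a * e / 2 by rewrite divr_gt0// mulr_gt0.
  have [x hx] := coercive_dense_range y e'0.
  exists x, (a * e / 2) => // x' /= hx'.
  rewrite -(ltr_pM2l a_gt0) (le_lt_trans (coercive_lower _))//.
  rewrite linearB/= -(subrK y (S x)) -addrA (le_lt_trans (rnormD _ _))//.
  by rewrite (rnormBC (S x)) [ltRHS]splitr ltrD.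
exists z; apply/eqP; rewrite eq_sym -subr_eq0; apply/eqP/rnorm0_eq0/eqP.
rewrite eq_le rnorm_ge0 andbT; apply/ler_addgt0Pr => e e0; rewrite add0r.
(* One share of [e / (1 + b)] pays for the residual, [b] shares for the distance to the limit
   magnified by [S]. *)
have e1 : 0 < e / (1 + b) by rewrite divr_gt0// addr_gt0.
have hy : F (B (e / (1 + b))) by exists (e / (1 + b)).
have [x [/= hx1 hx2]] := @filter_ex _ F FF _ (@filterI _ F FF _ _ (hz _ e1) hy).
rewrite -(subrK (S x) y) -addrA (le_trans (rnormD _ _))// -linearB/=.
have -> : e = e / (1 + b) + b * (e / (1 + b)) by field; rewrite gt_eqF// addr_gt0.
apply: lerD; first exact: ltW.
rewrite (le_trans (coercive_upper _))// (ler_pM2l b_gt0) rnormBC; exact: ltW.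
Qed.

End CoerciveOperator.

(** * The canonical dual frame, reconstruction and Riesz representation *)

Section DualFrame.
Variables (R : realType) (k : base_field_kind) (H : hilbertType R k).
Variable Lambda : choiceType.
Local Notation K := (base_field R k).
Implicit Types (c : Lambda -> K) (F : {fset Lambda}).
Variables (u : Lambda -> H) (a b : R).
Hypotheses (a_gt0 : 0 < a) (le_ab : a <= b).
Hypothesis u_upper : forall x F,
  \sum_(l <- F) rnorm (analysis u x l) ^+ 2 <= b * rnorm x ^+ 2.
Hypothesis u_lower : forall x (e : R), 0 < e -> exists F,
  a * rnorm x ^+ 2 - e < \sum_(l <- F) rnorm (analysis u x l) ^+ 2.

Let b_gt0 : 0 < b. Proof. exact: lt_le_trans le_ab. Qed.
Local Notation w := (canonical_dual u).

Let S : {linear H -> H} := HB.pack (frame_operator u)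
  (GRing.isLinear.Build K H H *:%R (frame_operator u)
    (frame_operator_linear a_gt0 le_ab u_upper)).

Let S_coercive x : a * rnorm x ^+ 2 <= reK (inner (S x) x).
Proof. exact: (frame_operator_coercive a_gt0 le_ab u_upper u_lower). Qed.

Let S_sqr x : rnorm (S x) ^+ 2 <= b * reK (inner (S x) x).
Proof. exact: (frame_operator_rnorm_sqr a_gt0 le_ab u_upper). Qed.

(** Surjectivity of [S] ensures that ['pinv_] returns a true preimage and not its default value
    0. *)
Lemma frame_operator_dual l : S (w l) = u l.
Proof.
have [x Sx] := coercive_surjective a_gt0 le_ab S_coercive S_sqr (u l).
by apply: pinvK; rewrite inE; exists x.
Qed.

Let S_sum_dual F c : S (\sum_(l <- F) c l *: w l) = \sum_(l <- F) c l *: u l.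
Proof.
by rewrite linear_sum; apply: eq_bigr => l _; rewrite -frame_operator_dual linearZ.
Qed.

(** As [S g] is the sum of the [c l *: u l], AM-GM bounds its inner product with [g] by half the sum
    of [|c l|^2] plus half of that same inner product. Absorbing the latter and using coercivity
    gives the factor [a^-1]. *)
Lemma dual_synthesis_bound : synthesis_bound w a^-1.
Proof.
move=> F c; set g := \sum_(l <- F) _ *: _.
rewrite ler_pdivlMl// (le_trans (S_coercive g))//.
have := reK_inner_sum_le F c u g; rewrite -S_sum_dual -/g => h1.
have h2 := sum_mul_AMGM F (fun l => rnorm (c l)) (fun l => rnorm (inner g (u l)))
  (@ltr01 R).
have h3 := frame_operator_ge_sum a_gt0 le_ab u_upper g F.
rewrite /analysis in h3; rewrite invr1 !mul1r in h2; rewrite /= in h1 *.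
lra.
Qed.

(** [S] sends these partial sums to those defining [S x]; the lower bound on [S] pulls the
    convergence back. *)
Lemma dual_reconstruction x : has_sum (fun l => analysis u x l *: w l) x.
Proof.
apply/has_sumP => e e0.
have [F0 hF0] := (has_sumP _ _).1
  (frame_operator_has_sum a_gt0 le_ab u_upper (x := x)) _ (mulr_gt0 a_gt0 e0).
exists F0 => F /hF0; rewrite -S_sum_dual -[frame_operator u x]/(S x) -linearB.
by move=> /(le_lt_trans (coercive_lower S_coercive _)); rewrite ltr_pM2l.
Qed.

(* Riesz: phi x = \sum <x, u_l> phi (w_l), so phi is represented by the sum of
   the conjugates of phi (w_l) times u_l. *)
Lemma frame_riesz (phi : {linear H -> K^o}) (L : R) : 0 <= L ->
  (forall x, rnorm (phi x : K) <= L * rnorm x) ->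
  exists z, forall x, phi x = inner x z.
Proof.
move=> L0 hphi; pose c l := conjK (phi (w l)).
(* Testing [phi] on the combination of the [w l] with coefficients [c l] returns [T] itself, so
   boundedness gives [T^2 <= L^2 a^-1 T], and one factor [T] cancels. *)
have hc F : \sum_(l <- F) rnorm (c l) ^+ 2 <= L ^+ 2 * a^-1.
  set T := \sum_(l <- F) _.
  have T0 : 0 <= T by rewrite sumr_ge0// => l _; rewrite sqr_ge0.
  have phiT : phi (\sum_(l <- F) c l *: w l) = ofR k T.
    rewrite linear_sum raddf_sum/=; apply: eq_bigr => l _.
    rewrite linearZ /= -mul_conjK_rnorm /c conjK_conj; reflexivity.
  have := hphi (\sum_(l <- F) c l *: w l).
  rewrite phiT rnorm_ofR ger0_norm// => hT.
  have := dual_synthesis_bound F c; rewrite -/T => hw.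
  have hT2 : T ^+ 2 <= L ^+ 2 * a^-1 * T.
    rewrite -mulrA (le_trans _ (ler_wpM2l (sqr_ge0 L) hw))// -exprMn.
    by rewrite ler_pXn2r ?nnegrE ?mulr_ge0 ?rnorm_ge0.
  have [T1|T1] := eqVneq T 0; first by rewrite T1 mulr_ge0 ?sqr_ge0// invr_ge0 ltW.
  have T_gt0 : 0 < T by rewrite lt_def T1.
  by rewrite -(ler_pM2r T_gt0) -expr2.
have [z hz] := synthesis_has_sum b_gt0
  (frame_synthesis_bound a_gt0 le_ab u_upper) hc.
exists z => x; apply/eqP; rewrite -subr_eq0; apply/eqP.
apply: (@rnorm0_eq0 R k K^o); apply/eqP.
rewrite eq_le rnorm_ge0 andbT; apply/ler_addgt0Pr => e e0; rewrite add0r.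
(* The truncation errors of [x] and [z] are weighted by [L] and by the norm of [x]; the 1 keeps [D]
   positive. *)
pose D := L + rnorm x + 1.
have D0 : 0 < D by rewrite ltr_wpDl// addr_ge0// rnorm_ge0.
have e1 : 0 < e / D by rewrite divr_gt0.
have [F1 hF1] := (has_sumP _ _).1 (dual_reconstruction (x := x)) _ e1.
have [F2 hF2] := (has_sumP _ _).1 hz _ e1.
have := hF1 (F1 `|` F2)%fset (fsubsetUl _ _).
have := hF2 (F1 `|` F2)%fset (fsubsetUr _ _).
set F := (F1 `|` F2)%fset => h2 h1.
have E : phi (\sum_(l <- F) analysis u x l *: w l) =
    inner x (\sum_(l <- F) c l *: u l).
  rewrite linear_sum (linear_sumr inner); apply: eq_bigr => l _.
  by rewrite linearZ /= innerZr /c conjK_conj mulrC.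
have -> : phi x - inner x z =
    phi (x - \sum_(l <- F) analysis u x l *: w l) -
    inner x (z - \sum_(l <- F) c l *: u l).
  by rewrite linearB innerBr E opprB addrA subrK.
rewrite (le_trans (rnormD (V := K^o) _ _))// rnormN.
have k1 := le_trans (hphi _) (ler_wpM2l L0 (ltW h1)).
have k2 := le_trans (cauchy_schwarz _ _) (ler_wpM2l (rnorm_ge0 x) (ltW h2)).
rewrite (le_trans (lerD k1 k2))// -mulrDl mulrCA ler_piMr ?(ltW e0)//.
by rewrite ler_pdivrMr// mul1r /D lerDl.
Qed.

End DualFrame.

(** * The adjoint identity *)

Section Adjoint.
Variables (R : realType) (k : base_field_kind) (X Y : hilbertType R k).
Local Notation K := (base_field R k).

(** The frame [u] of the whole space supplies, through [frame_riesz], the representative that [xget]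
    selects. *)
Lemma adjointP (Lambda : choiceType) (u : Lambda -> X) (A : {linear X -> Y}) :
  is_frame setT u -> bounded_operator A ->
  forall x y, inner (A x) y = inner x (adjoint A y).
Proof.
move=> /is_frame_bounds[a [b [a0 ab u_upper u_lower]]] [M hM] x y.
have phi_linear : linear (fun x => inner (A x) y : K^o).
  by move=> t x1 x2; rewrite linearP innerDl innerZl.
pose phi : {linear X -> K^o} := HB.pack (fun x => inner (A x) y : K^o)
  (GRing.isLinear.Build K X K^o *:%R _ phi_linear).
(* The absolute value makes the constant nonnegative, since the sign of [M] is not prescribed. *)
have phi_bounded z : rnorm (phi z : K) <= `|M| * rnorm y * rnorm z.
  rewrite (le_trans (cauchy_schwarz _ _))// mulrAC ler_wpM2r ?rnorm_ge0//.
  by rewrite (le_trans (hM z))// ler_wpM2r ?rnorm_ge0// ler_norm.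
have [z hz] := frame_riesz a0 ab (fun x F => u_upper x F I)
  (fun x e => u_lower x e I) (mulr_ge0 (normr_ge0 M) (rnorm_ge0 y)) phi_bounded.
by move: x; rewrite -/([set z | forall x, inner (A x) y = inner x z] (adjoint A y));
  apply: xgetPex; exists z.
Qed.

End Adjoint.

(** * Bessel bound for a frame of the closure of the range *)

Section RangeFrame.
Variables (R : realType) (k : base_field_kind) (X Y : hilbertType R k).
Variable Lambda : choiceType.

Lemma closure_rangeP (A : {linear X -> Y}) y : closure (range A) y <->
  forall e : R, 0 < e -> exists x, rnorm (y - A x) < e.
Proof.
split=> [hy e e0|hy].
  have e0' : 0 < ofR k e by rewrite ofR_gt0.
  have [_ [[x _ <-] /=]] := hy _ (nbhsx_ballx y _ e0').
  by rewrite -ball_normE /= -ofR_rnorm ltr_ofR; exists x.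
move=> B /nbhs_ballP[e /= e0 he].
have e0' := reK_gt0 e0.
have [x hx] := hy _ e0'; exists (A x); split; first by exists x.
apply: he; rewrite -ball_normE /=.
by rewrite -(ltr_ofR k) ofR_rnorm ge0_ofR_reK ?(ltW e0) in hx.
Qed.

Lemma closure_range_linear (A : {linear X -> Y}) t y z : closure (range A) y ->
  closure (range A) z -> closure (range A) (t *: y + z).
Proof.
rewrite !closure_rangeP => hy hz e e0.
have t0 : 0 < rnorm t + 1 by rewrite ltr_wpDl// (rnorm_ge0 (V := (base_field R k)^o)).
have [x hx] := hy (e / 2 / (rnorm t + 1)) (divr_gt0 (divr_gt0 e0 (ltr0Sn _ _)) t0).
have [x' hx'] := hz (e / 2) (divr_gt0 e0 (ltr0Sn _ _)).
exists (t *: x + x'); rewrite linearP opprD addrACA -scalerBr.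
rewrite (le_lt_trans (rnormD _ _))// [ltRHS]splitr ler_ltD// rnormZ.
rewrite (le_trans (ler_wpM2l (rnorm_ge0 (V := (base_field R k)^o) t) (ltW hx)))//.
rewrite mulrCA ler_piMr ?(divr_ge0 (ltW e0))//.
by rewrite ler_pdivrMr// mul1r lerDl.
Qed.

(** Finite combinations of [v] stay in the closure of the range, a subspace, so the frame inequality
    applies to them. *)
Lemma frame_range_synthesis_bound (A : {linear X -> Y}) (v : Lambda -> Y) :
  is_frame (closure (range A)) v -> exists2 b : R, 0 < b & synthesis_bound v b.
Proof.
move=> fv; have [a [b [a0 ab v_upper _]]] := is_frame_bounds fv.
have b0 : 0 < b := lt_le_trans a0 ab.
exists b => //; apply: synthesis_bound_span => // F c; apply: v_upper.
have h0 : closure (range A) 0.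
  by apply: subset_closure; exists 0 => //; rewrite linear0.
by elim/big_rec : _ => // l y _ hy; apply: closure_range_linear => //; exact: fv.1.
Qed.

End RangeFrame.

(** * Elementary estimates for soft-thresholding *)

Section SoftThreshold.
Variables (R : realType) (k : base_field_kind).
Local Notation K := (base_field R k).
Implicit Types (eta : K) (t : R).

Let rnormK_ge0 (z : K) : 0 <= rnorm z.
Proof. exact: (rnorm_ge0 (V := K^o)). Qed.

Lemma signE eta : eta = sign eta * ofR k (rnorm eta).
Proof.
rewrite /sign ofR_rnormK; have [->|e0] := eqVneq eta 0; first by rewrite mul0r.
by rewrite divfK// normr_eq0.
Qed.

Lemma rnorm_sign_le1 eta : rnorm (sign eta) <= 1.
Proof.
rewrite /sign; have [_|e0] := eqVneq eta 0; first by rewrite (rnorm0 (K^o)) ler01.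
by rewrite -(ler_ofR k) ofR_rnormK rmorph1 normf_div normr_id divff ?normr_eq0.
Qed.

Lemma rnorm_soft_le eta t : rnorm (soft eta t) <= Num.max 0 (rnorm eta - t).
Proof.
have m0 : 0 <= Num.max 0 (rnorm eta - t) by rewrite le_max lexx.
by rewrite /soft rnormM rnorm_ofR ger0_norm// ler_piMl ?rnorm_sign_le1.
Qed.

(** Both terms share the factor [sign eta], so only the moduli are compared: they differ by [t], or
    by [rnorm eta] below the threshold. *)
Lemma rnorm_soft_sub_le eta t : 0 <= t -> rnorm (soft eta t - eta) <= t.
Proof.
move=> t0; rewrite [X in _ - X]signE /soft -mulrBr -rmorphB rnormM rnorm_ofR.
rewrite (le_trans (ler_piMl _ (rnorm_sign_le1 _)))// ler_norml.
have e0 : 0 <= rnorm eta := rnormK_ge0 eta; move: e0; set m := rnorm eta => e0.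
case: (leP 0 (m - t)) => h; apply/andP; split; lra.
Qed.

End SoftThreshold.

(** * Coefficient errors off and on the support *)

Section ThresholdedCoefficients.
Variables (R : realType) (k : base_field_kind).
Local Notation K := (base_field R k).

(* On the noise-only indices the entry vanishes unless |eta| kappa > t, which
   trades the unbounded factor 1 / kappa for |eta| / t. *)
Lemma rnorm_soft_div_le (eta : K) (t t0 kappa : R) : 0 < kappa -> 0 < t0 ->
  t0 <= t -> rnorm (soft eta (t / kappa) / ofR k kappa) <= rnorm eta ^+ 2 / t0.
Proof.
move=> kappa0 t0_gt0 tt0; have m0 : 0 <= rnorm eta := rnorm_ge0 (eta : K^o).
rewrite -fmorphV rnormM rnorm_ofR ger0_norm ?invr_ge0 ?(ltW kappa0)//.
rewrite ler_pdivrMr// (le_trans (rnorm_soft_le _ _))//.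
move: m0; set m := rnorm eta => m0.
case: (leP 0 (m - t / kappa)) => h; last first.
  by rewrite mulr_ge0 ?divr_ge0 ?sqr_ge0// ltW.
have tm : t <= m * kappa by rewrite -ler_pdivrMr// -subr_ge0.
rewrite (@le_trans _ _ m)//.
  by rewrite lerBlDr lerDl divr_ge0// ltW// (lt_le_trans t0_gt0).
rewrite mulrAC ler_pdivlMr// expr2 -mulrA ler_wpM2l//.
exact: le_trans tm.
Qed.

(** Inserting [eta] splits the error into thresholding bias and data error. The factor [1 / kappa]
    is harmless on a finite support, where this is applied. *)
Lemma rnorm_soft_div_sub_le (eta a : K) (t kappa : R) : 0 < kappa -> 0 <= t ->
  rnorm (soft eta t / ofR k kappa - a) <=
  (t + rnorm (eta - ofR k kappa * a)) / kappa.
Proof.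
move=> kappa0 t0; have kK : ofR k kappa != 0 by rewrite fmorph_eq0 gt_eqF.
have -> : soft eta t / ofR k kappa - a =
    ((soft eta t - eta) + (eta - ofR k kappa * a)) / ofR k kappa.
  by rewrite addrA subrK mulrBl (mulrC _ a) mulfK.
rewrite -fmorphV rnormM rnorm_ofR ger0_norm ?invr_ge0 ?(ltW kappa0)//.
rewrite ler_wpM2r ?invr_ge0 ?(ltW kappa0)//.
by rewrite (le_trans (rnormD (V := K^o) _ _))// lerD2r rnorm_soft_sub_le.
Qed.

End ThresholdedCoefficients.

(** * The linear convergence rate *)

Lemma ereal_inf_range_lower (R : realType) (T : Type) (d : T -> R) :
  (0 < ereal_inf (range (fun l => (d l)%:E)))%E ->
  exists2 d0 : R, 0 < d0 & forall l, d0 <= d l.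
Proof.
have lb l : (ereal_inf (range (fun l => (d l)%:E)) <= (d l)%:E)%E.
  by apply: ereal_inf_lbound; exists l.
move: (ereal_inf _) lb => [r| |]//= lb; rewrite ?lte_fin => d0.
  by exists r => // l; rewrite -lee_fin.
(* An infimum [+oo] means an empty index type, so any positive constant serves. *)
by exists 1 => // l; have := lb l.
Qed.

Theorem theorem4p4 (R : realType) (k : base_field_kind) (X Y : hilbertType R k)
    (A : {linear X -> Y}) (hA : bounded_operator A)
    (Lambda : choiceType) (u : Lambda -> X) (v : Lambda -> Y)
    (kappa : Lambda -> R) (hDFD : is_DFD A u v kappa)
    (d : Lambda -> R) (hd : (0 < ereal_inf (range (fun l => (d l)%:E)))%E)
    (x : X) (hx : finite_set [set l | analysis u x l != 0])
    (hkappa : forall l, analysis u x l != 0 -> kappa l != 0)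
    (C : R) (hC : 0 < C) :
  exists2 c : R, 0 < c &
    forall delta : R, 0 < delta ->
    forall y : Y, rnorm (A x - y) <= delta ->
      rnorm (DFD_estimator u v kappa d (C * delta) y - x) <= c * delta.
Proof.
have [kappa_gt0 frame_u frame_v adj_v] := hDFD.
have [a [b [a0 ab u_upper' u_lower']]] := is_frame_bounds frame_u.
have u_upper z F := u_upper' z F I.
have u_lower z e := u_lower' z e I.
have [beta beta0 v_bound] := frame_range_synthesis_bound frame_v.
have [d0 d0_gt0 dd0] := ereal_inf_range_lower hd.
have d_ge0 l : 0 <= d l := le_trans (ltW d0_gt0) (dd0 l).
have Cd0 : 0 < C * d0 by rewrite mulr_gt0.
pose Omega := fset_set [set l | analysis u x l != 0].
(* Error per unit of [delta] on the support: threshold plus data error, both divided by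
   [kappa l]. *)
pose m l := (C * d l / kappa l + (1 + beta)) / kappa l.
pose h l := if l \in Omega then m l ^+ 2 else 0.
(* In the second term one [beta] comes from a pointwise Bessel bound, the other from the summed
   one. *)
pose M := \sum_(l <- Omega) m l ^+ 2 + beta / (C * d0) ^+ 2 * beta.
have M0 : 0 <= M.
  rewrite addr_ge0 ?sumr_ge0// => [l _|]; rewrite ?sqr_ge0//.
  by rewrite mulr_ge0 ?divr_ge0 ?sqr_ge0// ltW.
have Ma0 : 0 <= a^-1 * M by rewrite mulr_ge0// invr_ge0 ltW.
exists (Num.sqrt (a^-1 * M) + 1); first by rewrite ltr_wpDl// sqrtr_ge0.
move=> delta delta0 y hy.
pose z := y - A x; have hz : rnorm z <= delta by rewrite rnormBC.
have hz2 : rnorm z ^+ 2 <= delta ^+ 2.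
  by rewrite ler_pXn2r ?nnegrE ?rnorm_ge0// ltW.
have zv (F : {fset Lambda}) : \sum_(l <- F) rnorm (analysis v z l) ^+ 2 <= beta * delta ^+ 2.
  by rewrite (le_trans (analysis_bound beta0 v_bound F z))// ler_wpM2l// ltW.
have zv1 l : rnorm (analysis v z l) ^+ 2 <= beta * delta ^+ 2.
  by have := zv [fset l]%fset; rewrite big_seq_fset1.
(* [1 + beta] is a root-free majorant of the square root of [beta]. *)
have zv2 l : rnorm (analysis v z l) <= (1 + beta) * delta.
  rewrite -(ler_pXn2r (n := 2)) ?nnegrE//; last first.
  - by rewrite mulr_ge0// ltW// addr_gt0.
  - exact: (rnorm_ge0 (_ : (base_field R k)^o)).
  rewrite (le_trans (zv1 l))// exprMn ler_wpM2r ?sqr_ge0//.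
  by rewrite sqrrD; have := sqr_ge0 beta; lra.
(* The DFD relation makes [kappa l] times the coefficient of [x] the exact data coefficient, so only
   noise remains. *)
have etaE l : analysis v y l - ofR k (kappa l) * analysis u x l = analysis v z l.
  rewrite /analysis /z innerBl (adjointP frame_u hA) adj_v innerZr conjK_ofR.
  by [].
pose xi := pointwise_div kappa
  (soft_threshold (fun l => C * delta * d l / kappa l) (analysis v y)).
pose e l := xi l - analysis u x l.
have e_le l : rnorm (e l) ^+ 2 <=
    h l * delta ^+ 2 + beta / (C * d0) ^+ 2 * rnorm (analysis v z l) ^+ 2.
  have e_ge0 : 0 <= rnorm (e l) := rnorm_ge0 (e l : (base_field R k)^o).
  have r_ge0 : 0 <= beta / (C * d0) ^+ 2 * rnorm (analysis v z l) ^+ 2.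
    by rewrite mulr_ge0 ?sqr_ge0// divr_ge0 ?sqr_ge0// ltW.
  rewrite /h; case: ifPn => hl.
    apply: ler_wpDr => //.
    have m_ge0 : 0 <= m l.
      rewrite divr_ge0 ?(ltW (kappa_gt0 l))// addr_ge0//.
        by rewrite divr_ge0 ?(ltW (kappa_gt0 l))// mulr_ge0// ltW.
      by rewrite ltW// addr_gt0.
    rewrite -exprMn ler_pXn2r ?nnegrE ?(mulr_ge0 m_ge0 (ltW delta0))//.
    have t_ge0 : 0 <= C * delta * d l / kappa l.
      by rewrite divr_ge0 ?(ltW (kappa_gt0 l))// !mulr_ge0// ltW.
    rewrite (le_trans (rnorm_soft_div_sub_le _ _ (kappa_gt0 l) t_ge0))//.
    rewrite etaE /m [leRHS]mulrAC ler_wpM2r ?invr_ge0 ?(ltW (kappa_gt0 l))//.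
    rewrite mulrDl; apply: lerD => //.
    by rewrite (_ : C * delta * _ / _ = C * d l / kappa l * delta)//; ring.
  have x0 : analysis u x l = 0.
    have [//|x0] := eqVneq (analysis u x l) 0.
    by move/negP: hl; case; rewrite in_fset_set//; exact: mem_set.
  rewrite mul0r add0r.
  have eta : analysis v y l = analysis v z l by rewrite -etaE x0 mulr0 subr0.
  have Cdd0 : 0 < C * delta * d0 by rewrite !mulr_gt0.
  have Cdd : C * delta * d0 <= C * delta * d l by rewrite ler_pM2l// mulr_gt0.
  have := rnorm_soft_div_le (analysis v z l) (kappa_gt0 l) Cdd0 Cdd.
  have -> : soft (analysis v z l) (C * delta * d l / kappa l) /
      ofR k (kappa l) = e l.
    by rewrite /e /xi /pointwise_div /soft_threshold x0 subr0 eta.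
  move=> he; have := zv1 l; move: he r_ge0.
  set n2 := rnorm (analysis v z l) ^+ 2 => he r_ge0 hn2.
  have n2_ge0 : 0 <= n2 by exact: sqr_ge0.
  have q_ge0 : 0 <= n2 / (C * delta * d0) by rewrite divr_ge0// ltW.
  have he2 : rnorm (e l) ^+ 2 <= (n2 / (C * delta * d0)) ^+ 2.
    by rewrite ler_pXn2r ?nnegrE.
  rewrite (le_trans he2)//.
  (* One factor [n2] is kept for summation; the other is at most [beta * delta ^+ 2], which cancels
     the [delta ^+ 2] of the denominator. *)
  have -> : (n2 / (C * delta * d0)) ^+ 2 = n2 * (n2 / (C * delta * d0) ^+ 2).
    by rewrite expr_div_n expr2 mulrA.
  rewrite [leRHS]mulrC ler_wpM2l// ler_pdivrMr ?exprn_gt0//.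
  rewrite (le_trans hn2)// le_eqVlt; apply/orP; left; apply/eqP.
  by field; rewrite !gt_eqF.
have h_sum (F : {fset Lambda}) : \sum_(l <- F) h l <= \sum_(l <- Omega) m l ^+ 2.
  have h_ge0 l : 0 <= h l by rewrite /h; case: ifP; rewrite ?sqr_ge0.
  rewrite (le_trans (ler_sum_fsubset h_ge0 (fsubsetUl F Omega)))//.
  rewrite (sum_setD _ (fsubsetUr F Omega)) [X in _ + X]big1_fset ?addr0.
    by rewrite big_seq [leRHS]big_seq ler_sum// => l lO; rewrite /h lO.
  by move=> l; rewrite inE => /andP[/negbTE lO _] _; rewrite /h lO.
have e_sum (F : {fset Lambda}) : \sum_(l <- F) rnorm (e l) ^+ 2 <= M * delta ^+ 2.
  rewrite (le_trans (ler_sum _ (fun l _ => e_le l)))// big_split/=.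
  rewrite -mulr_suml -mulr_sumr /M mulrDl; apply: lerD.
    by rewrite ler_wpM2r ?sqr_ge0.
  by rewrite -[leRHS]mulrA ler_wpM2l// divr_ge0 ?sqr_ge0// ltW.
have ai0 : 0 < a^-1 by rewrite invr_gt0.
have w_bound := dual_synthesis_bound a0 ab u_upper u_lower.
have [g hg] := synthesis_has_sum ai0 w_bound e_sum.
(* The coefficients [xi] are [e] plus those of [x]; the dual frame sums the former to [g] and
   reconstructs [x] from the latter. *)
have -> : DFD_estimator u v kappa d (C * delta) y = g + x.
  apply: has_sum_unique.
  have := has_sumD hg (dual_reconstruction a0 ab u_upper u_lower (x := x)).
  congr has_sum; apply/funext => l.
  by rewrite -scalerDl /e subrK.
rewrite addrK.
have g_le := synthesis_limit_bound ai0 w_bound e_sum hg.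
rewrite mulrA -(sqr_sqrtr Ma0) -exprMn in g_le.
rewrite ler_pXn2r ?nnegrE ?rnorm_ge0 ?mulr_ge0 ?sqrtr_ge0 ?(ltW delta0)// in g_le.
by rewrite (le_trans g_le)// ler_wpM2r ?(ltW delta0)// lerDl.
Qed.
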